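(* Let $T$ be an oriented non-equilateral triangle. The mapping $\imath:\mathbb I\to\mathbb I$ defined by $$\imath(\xi)=\mathsf p(\varkappa_T)\diamond\xi^{\ominus},\qquad \xi\in\mathbb I,$$ maps the interior of $\mathbb M_T$ onto its exterior $\mathbb I\setminus\mathbb M_T$. The triangles $\mathcal C_\xi(T)$ and $\mathcal C_{\imath(\xi)}(T)$ are reversely similar for all $\xi\in\mathbb M_T$.
   Context: An oriented triangle is written as the ordered triple $T=(a,b,c)$ of its side lengths taken counterclockwise (positive reals with $|a-b|<c<a+b$). Oriented triangles $(a,b,c)$ and $(x,y,z)$ are reversely similar if $\frac az=\frac by=\frac cx$ or $\frac ay=\frac bx=\frac cz$ or $\frac ax=\frac bz=\frac cy$. Ceva's operators: for $\rho\in\mathbb R$, $\mathcal C_\rho(a,b,c)=(x_\rho,y_\rho,z_\rho)$ with $x_\rho=\sqrt{\rho a^2+(1-\rho)b^2+\rho(\rho-1)c^2}$, $y_\rho=\sqrt{(1-\rho)a^2+\rho(\rho-1)b^2+\rho c^2}$, $z_\rho=\sqrt{\rho(\rho-1)a^2+\rho b^2+(1-\rho)c^2}$ (again side lengths of an oriented triangle); $\mathcal C_\infty(a,b,c)=(c,b,a)$. For non-equilateral $T=(a,b,c)$ put $\varkappa_T=\frac{a^2-b^2}{a^2-c^2}$ if $a\ne c$ and $\varkappa_T=\infty$ if $a=c$. Let $\mathbb I=[0,1)$. The map $\mathsf p:\mathbb R\cup\{\infty\}\to\mathbb I$ is $\mathsf p(\rho)=\frac1{1-\rho}$ if $\rho<0$,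 $\mathsf p(\infty)=0$, $\mathsf p(\rho)=\rho$ if $0\le\rho<1$, $\mathsf p(\rho)=1-\frac1\rho$ if $\rho\ge1$. The operation $\diamond$ on $\mathbb I$ is $\rho\diamond\tau=\frac{\rho+\tau-\rho\tau}{1-\rho\tau}$ if $\rho+\tau<1$ and $\rho\diamond\tau=\frac{\rho+\tau-1}{\rho+\tau-\rho\tau}$ if $\rho+\tau\ge1$. $(\mathbb I,\diamond)$ is a commutative group with identity $0$; the inverse of $\xi$ is denoted $\xi^{\ominus}$, so $0^{\ominus}=0$ and $\xi^{\ominus}=1-\xi$ for $0<\xi<1$. For $\kappa\in\mathbb I$ put $\sqrt[\square]{\kappa}=\frac{\kappa}{1+\sqrt{1-\kappa+\kappa^2}}\in[0,\tfrac12)$. Finally $\mathbb M_T=\bigl[\sqrt[\square]{\mathsf p(\varkappa_T)},\ \tfrac12\diamond\sqrt[\square]{\mathsf p(\varkappa_T)}\bigr]\subset\mathbb I$; its interior is the corresponding open interval. *)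

(* Defs.v *)
From HB Require Import structures.
From mathcomp Require Import all_boot all_order all_algebra.
From mathcomp Require Import all_classical all_reals.
From mathcomp Require Import ring lra.
Set Implicit Arguments. Unset Strict Implicit. Unset Printing Implicit Defensive.
Import Order.TTheory GRing.Theory Num.Theory.
Local Open Scope classical_set_scope.
Local Open Scope ring_scope.

Definition is_triangle (R : realType) (a b c : R) : Prop :=
  [/\ 0 < a, 0 < b, 0 < c & `|a - b| < c < a + b].

(* Side lengths listed counterclockwise: the order carries the orientation. *)
Record otriangle (R : realType) := OTriangle {
  side_a : R;
  side_b : R;
  side_c : R;
  otriangleP : is_triangle side_a side_b side_c }.

Definition equilateral (R : realType) (T : otriangle R) : Prop :=
  side_a T = side_b T /\ side_b T = side_c T.

Definition reversely_similar (R : realType) (T U : otriangle R) : Prop :=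
  let: (a, b, c) := (side_a T, side_b T, side_c T) in
  let: (x, y, z) := (side_a U, side_b U, side_c U) in
  [\/ a / z = b / y /\ b / y = c / x,
      a / y = b / x /\ b / x = c / z |
      a / x = b / z /\ b / z = c / y].

Definition ceva_x (R : realType) (rho a b c : R) : R :=
  Num.sqrt (rho * a ^+ 2 + (1 - rho) * b ^+ 2 + rho * (rho - 1) * c ^+ 2).

Definition ceva_y (R : realType) (rho a b c : R) : R :=
  Num.sqrt ((1 - rho) * a ^+ 2 + rho * (rho - 1) * b ^+ 2 + rho * c ^+ 2).

Definition ceva_z (R : realType) (rho a b c : R) : R :=
  Num.sqrt (rho * (rho - 1) * a ^+ 2 + rho * b ^+ 2 + (1 - rho) * c ^+ 2).

(* Sixteen times the squared area, as a function of the squared sides (Heron). *)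
Definition heron (R : realType) (A B C : R) : R :=
  4 * A * B - (A + B - C) ^+ 2.

Lemma is_triangle_heron (R : realType) (a b c : R) :
  is_triangle a b c -> 0 < heron (a ^+ 2) (b ^+ 2) (c ^+ 2).
Proof.
move=> [a0 b0 c0 /andP[]]; rewrite ltr_norml => /andP[h1 h2] h3.
have -> : heron (a ^+ 2) (b ^+ 2) (c ^+ 2) =
    (a + b + c) * (a + b - c) * ((c - a + b) * (c + a - b)).
  by rewrite /heron; ring.
by rewrite !mulr_gt0 //; lra.
Qed.

Lemma heron_is_triangle (R : realType) (A B C : R) :
  0 < A -> 0 < B -> 0 < C -> 0 < heron A B C ->
  is_triangle (Num.sqrt A) (Num.sqrt B) (Num.sqrt C).
Proof.
move=> A0 B0 C0.
rewrite -{1}(sqr_sqrtr (ltW A0)) -{1}(sqr_sqrtr (ltW B0)).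
rewrite -{1}(sqr_sqrtr (ltW C0)).
have: 0 < Num.sqrt A by rewrite sqrtr_gt0.
have: 0 < Num.sqrt B by rewrite sqrtr_gt0.
have: 0 < Num.sqrt C by rewrite sqrtr_gt0.
move: (Num.sqrt A) (Num.sqrt B) (Num.sqrt C) => a b c c0 b0 a0.
have -> : heron (a ^+ 2) (b ^+ 2) (c ^+ 2) =
    (a + b + c) * ((a + b - c) * (c ^+ 2 - (a - b) ^+ 2)).
  by rewrite /heron; ring.
rewrite pmulr_rgt0 => [h|]; last by rewrite !addr_gt0.
have habc : c < a + b.
  rewrite ltNge; apply/negP => hc.
  have hc2 : 0 < c ^+ 2 - (a - b) ^+ 2.
    have -> : c ^+ 2 - (a - b) ^+ 2 = (c - a + b) * (c + a - b) by ring.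
    by rewrite mulr_gt0 //; lra.
  by move: h; rewrite pmulr_lgt0 //; lra.
split=> //; rewrite habc andbT.
move: h; rewrite pmulr_rgt0 ?subr_gt0 // => h.
by rewrite ltr_norml; apply/andP; split; rewrite ltNge; apply/negP => ?; nra.
Qed.

Lemma ceva_arg_gt0 (R : realType) (rho A B C : R) :
  0 < C -> 0 < heron A B C ->
  0 < rho * A + (1 - rho) * B + rho * (rho - 1) * C.
Proof.
move=> C0 h; have C4 : 0 < 4 * C by lra.
rewrite -(pmulr_rgt0 _ C4).
have -> : 4 * C * (rho * A + (1 - rho) * B + rho * (rho - 1) * C) =
    (2 * C * rho + A - B - C) ^+ 2 + heron A B C.
  by rewrite /heron; ring.
by rewrite ltr_wpDl ?sqr_ge0.
Qed.

Lemma ceva_triangle (R : realType) (rho a b c : R) : is_triangle a b c ->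
  is_triangle (ceva_x rho a b c) (ceva_y rho a b c) (ceva_z rho a b c).
Proof.
move=> T; have h := is_triangle_heron T; case: T => a0 b0 c0 _.
have [A0 B0 C0] : [/\ 0 < a ^+ 2, 0 < b ^+ 2 & 0 < c ^+ 2].
  by rewrite !exprn_gt0.
rewrite /ceva_x /ceva_y /ceva_z.
move: (a ^+ 2) (b ^+ 2) (c ^+ 2) A0 B0 C0 h => A B C A0 B0 C0 h.
have hBCA : heron B C A = heron A B C by rewrite /heron; ring.
have hCAB : heron C A B = heron A B C by rewrite /heron; ring.
apply: heron_is_triangle.
- exact: ceva_arg_gt0.
- have := @ceva_arg_gt0 _ rho C A B B0; rewrite hCAB => /(_ h); lra.
- have := @ceva_arg_gt0 _ rho B C A A0; rewrite hBCA => /(_ h); lra.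
have -> : heron (rho * A + (1 - rho) * B + rho * (rho - 1) * C)
    ((1 - rho) * A + rho * (rho - 1) * B + rho * C)
    (rho * (rho - 1) * A + rho * B + (1 - rho) * C) =
    (1 - rho + rho ^+ 2) ^+ 2 * heron A B C.
  by rewrite /heron; ring.
by rewrite mulr_gt0 // exprn_gt0 //; nra.
Qed.

Definition ceva (R : realType) (rho : R) (T : otriangle R) : otriangle R :=
  OTriangle (ceva_triangle rho (otriangleP T)).

(* The projective line over R is [option R], with [None] for infinity. *)
Definition varkappa (R : realType) (T : otriangle R) : option R :=
  if side_a T == side_c T then None
  else Some ((side_a T ^+ 2 - side_b T ^+ 2) /
             (side_a T ^+ 2 - side_c T ^+ 2)).

Definition II (R : realType) : set R := [set` `[0, 1[%R].
Arguments II : clear implicits.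

Definition pp (R : realType) (r : option R) : R :=
  if r is Some rho then
    if rho < 0 then (1 - rho)^-1
    else if rho < 1 then rho
    else 1 - rho^-1
  else 0.

(* Meaningful for rho and tau in [0, 1[, where the denominators are positive. *)
Definition diamond (R : realType) (rho tau : R) : R :=
  if rho + tau < 1 then (rho + tau - rho * tau) / (1 - rho * tau)
  else (rho + tau - 1) / (rho + tau - rho * tau).

Definition dinv (R : realType) (xi : R) : R :=
  if xi == 0 then 0 else 1 - xi.

Lemma dinv_II (R : realType) (xi : R) : II R xi -> II R (dinv xi).
Proof.
rewrite /II /= !in_itv /= /dinv => /andP[x0 x1].
by case: eqVneq => [_|xN0]; [rewrite lexx ltr01 | lra].
Qed.

Lemma diamond_eq0 (R : realType) (xi tau : R) : II R xi -> II R tau ->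
  (diamond xi tau = 0) <-> (tau = dinv xi).
Proof.
rewrite /II /= !in_itv /= /diamond /dinv => /andP[x0 x1] /andP[t0 t1].
have [lt1|ge1] := ltP.
  have d0 : 1 - xi * tau != 0 by rewrite gt_eqF //; nra.
  split=> [/eqP|].
    rewrite mulf_eq0 invr_eq0 (negPf d0) orbF => /eqP e.
    have xi0 : xi = 0 by nra.
    by rewrite xi0 eqxx; move: e; rewrite xi0; lra.
  case: eqVneq => [-> ->|_ e]; first by rewrite addr0 mulr0 subr0 mul0r.
  by lra.
have d0 : xi + tau - xi * tau != 0 by rewrite gt_eqF //; nra.
split=> [/eqP|].
  rewrite mulf_eq0 invr_eq0 (negPf d0) orbF => /eqP e.
  by case: eqVneq => [xi0|_]; lra.
case: eqVneq => [-> e|_ ->]; first by lra.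
have -> : xi + (1 - xi) - 1 = 0 by ring.
by rewrite mul0r.
Qed.

Definition square_root (R : realType) (kappa : R) : R :=
  kappa / (1 + Num.sqrt (1 - kappa + kappa ^+ 2)).

Definition MM_left (R : realType) (T : otriangle R) : R :=
  square_root (pp (varkappa T)).

Definition MM_right (R : realType) (T : otriangle R) : R :=
  diamond (1 / 2) (square_root (pp (varkappa T))).

Definition MM (R : realType) (T : otriangle R) : set R :=
  [set` `[MM_left T, MM_right T]%R].

Definition MM_interior (R : realType) (T : otriangle R) : set R :=
  [set` `]MM_left T, MM_right T[%R].

Definition iota_map (R : realType) (T : otriangle R) (xi : R) : R :=
  diamond (pp (varkappa T)) (dinv xi).

(* Main.v *)
Require Import Defs.
From mathcomp Require Import all_boot all_order all_algebra.
From mathcomp Require Import all_classical all_reals.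
From mathcomp Require Import ring lra.
Import Order.TTheory GRing.Theory Num.Theory.
Local Open Scope classical_set_scope.
Local Open Scope ring_scope.

(** Write k for [pp (varkappa T)]. Unfolding the definitions, the map
    [xi |-> diamond k (dinv xi)] is the Moebius involution
    f(xi) = (k - xi) / (1 - xi + k xi) for xi <= k, and
    1 / (1 - f(xi)) = (1 - xi + k xi) / (1 - k + k xi) for xi > k. Both branches
    are decreasing; the first permutes [0, k] and the second ]k, 1[, so the map
    is an involution of [0, 1[. The numbers s = [square_root k] <= k and
    r = [diamond (1 / 2) s] > k are the fixed points of the two branches. A
    decreasing map reverses the two sides of its fixed point, so ]s, k] is
    exchanged with [0, s[ and ]k, r[ with ]r, 1[: this is the statement about
    the interior and the exterior ([reflection_swap], [reflection_image]).

    For the similarity, everything is expressed in the squared sides (A, B, C),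
    on which the Ceva operators are linear. The three finite branches of [pp]
    correspond to the three rotations of (A, B, C): after a suitable rotation,
    k satisfies A - B = k (A - C) ([pp_varkappa]). Since the Ceva operators
    commute with rotations and reverse similarity is invariant under them, it
    suffices to treat that normalized relation. There the squared sides of the
    image triangle are the multiples, by (1 - k + k^2) / D^2 with D the
    denominator of the branch, of those of the original one in reversed cyclic
    order ([ceva_sq_le], [ceva_sq_gt]). *)

(** * The reflection of the circle [0, 1[ *)

Section Reflection.
Set Implicit Arguments.
Unset Strict Implicit.
Variable R : realType.
Implicit Types k s r xi : R.

Lemma IIE xi : II R xi = (0 <= xi < 1) :> Prop.
Proof. by rewrite /II /= in_itv. Qed.

Lemma pp_II (t : option R) : 0 <= pp t < 1.
Proof.
case: t => [t|] /=; last by rewrite lexx ltr01.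
case: (ltP t 0) => t0.
  have d0 : 0 < 1 - t by lra.
  by rewrite invr_ge0 ltW //= invf_lt1 //; lra.
case: (ltP t 1) => t1; first by rewrite t0.
have tp : 0 < t by lra.
have : 0 < t^-1 by rewrite invr_gt0.
have : t^-1 <= 1 by rewrite invf_le1.
by move=> ? ?; apply/andP; split; lra.
Qed.

Lemma diamond_dinv_le k xi : k < 1 -> 0 <= xi -> xi <= k ->
  diamond k (dinv xi) = (k - xi) / (1 - xi + k * xi).
Proof.
move=> k1 x0 xk; rewrite /diamond /dinv.
case: eqVneq => [->|_].
  by rewrite addr0 k1 !mulr0 !subr0 addr0.
have -> : (k + (1 - xi) < 1) = false by lra.
by congr (_ / _); ring.
Qed.

Lemma diamond_dinv_gt k xi : 0 <= k -> k < xi ->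
  diamond k (dinv xi) = (1 - xi + k * xi) / (1 - k + k * xi).
Proof.
move=> k0 kx; rewrite /diamond /dinv gt_eqF; last exact: le_lt_trans kx.
have -> : k + (1 - xi) < 1 by lra.
by congr (_ / _); ring.
Qed.

Lemma reflection_le k xi : k < 1 -> 0 <= xi -> xi <= k ->
  0 <= diamond k (dinv xi) <= k.
Proof.
move=> k1 x0 xk; rewrite diamond_dinv_le //.
have d0 : 0 < 1 - xi + k * xi by nra.
apply/andP; split; first by rewrite divr_ge0 ?subr_ge0 // ltW.
rewrite ler_pdivrMr // -subr_ge0.
have -> : k * (1 - xi + k * xi) - (k - xi) = xi * (1 - k + k ^+ 2) by ring.
by rewrite mulr_ge0 //; nra.
Qed.

Lemma reflection_gt k xi : 0 <= k -> k < 1 -> k < xi -> xi < 1 ->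
  k < diamond k (dinv xi) < 1.
Proof.
move=> k0 k1 kx x1; rewrite diamond_dinv_gt //.
have d0 : 0 < 1 - k + k * xi by nra.
rewrite ltr_pdivlMr // ltr_pdivrMr //; apply/andP; split; last by nra.
rewrite -subr_gt0.
have -> : 1 - xi + k * xi - k * (1 - k + k * xi) =
  (1 - xi) * (1 - k + k ^+ 2) by ring.
by rewrite mulr_gt0 //; nra.
Qed.

Lemma reflection_II k xi : 0 <= k < 1 -> 0 <= xi < 1 ->
  0 <= diamond k (dinv xi) < 1.
Proof.
move=> /andP[k0 k1] /andP[x0 x1]; case: (leP xi k) => xk.
  by have /andP[-> /le_lt_trans->] := reflection_le k1 x0 xk.
by have /andP[/ltW/(le_trans k0)-> ->] := reflection_gt k0 k1 xk x1.
Qed.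

Lemma reflectionK k xi : 0 <= k < 1 -> 0 <= xi < 1 ->
  diamond k (dinv (diamond k (dinv xi))) = xi.
Proof.
move=> /andP[k0 k1] /andP[x0 x1]; have nk : 1 - k + k ^+ 2 != 0.
  by rewrite gt_eqF //; nra.
case: (leP xi k) => xk.
  have /andP[y0 yk] := reflection_le k1 x0 xk.
  rewrite (diamond_dinv_le k1 y0 yk) diamond_dinv_le //.
  have d0 : 1 - xi + k * xi != 0 by rewrite gt_eqF //; nra.
  field; rewrite d0 /=.
  (* The denominators of the iterate reduce to the norm of k. *)
have -> // : 1 - xi + k * xi - (k - xi) + k * (k - xi) = 1 - k + k ^+ 2.
  by ring.
have /andP[yk y1] := reflection_gt k0 k1 xk x1.
rewrite (diamond_dinv_gt k0 yk) diamond_dinv_gt //.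
have d0 : 1 - k + k * xi != 0 by rewrite gt_eqF //; nra.
field; rewrite d0 /=.
have -> // : (1 - k) * (1 - k + k * xi) + k * (1 - xi + k * xi) = 1 - k + k ^+ 2.
by ring.
Qed.

(** The square root of k solves (1 - k) s^2 - 2 s + k = 0, which says that s is
    fixed by the first branch of the reflection. *)
Lemma square_rootP k (s := square_root k) : 0 <= k < 1 ->
  [/\ 0 <= s, s < 1 / 2, s <= k & k - s = s * (1 - s + k * s)].
Proof.
move=> /andP[k0 k1].
have arg0 : 0 <= 1 - k + k ^+ 2 by nra.
have S2 := sqr_sqrtr arg0; rewrite /s /square_root.
(* This bound is what places the root below 1/2. *)
have kS : k < Num.sqrt (1 - k + k ^+ 2).
  by rewrite -[ltLHS](ger0_norm k0) -sqrtr_sqr ltr_sqrt; nra.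
move: (Num.sqrt _) S2 kS => S S2 kS.
have d0 : 0 < 1 + S by lra.
have s0 : 0 <= k / (1 + S) by rewrite divr_ge0 // ltW.
split=> //.
- by rewrite ltr_pdivrMr //; lra.
- by rewrite ler_pdivrMr //; nra.
- apply/eqP; rewrite -subr_eq0.
  have -> : k - k / (1 + S) - k / (1 + S) * (1 - k / (1 + S) + k * (k / (1 + S)))
    = k * (S ^+ 2 - (1 - k + k ^+ 2)) / (1 + S) ^+ 2.
    by field; rewrite gt_eqF.
  by rewrite S2 subrr mulr0 mul0r.
Qed.

(** Rotating s by a half turn gives the other fixed point of the reflection,
    which lies on the second branch. *)
Lemma half_turn_square_rootP k (r := diamond (1 / 2) (square_root k)) :
  0 <= k < 1 ->
  [/\ k < r, r < 1 & 1 - r + k * r = r * (1 - k + k * r)].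
Proof.
move=> k01; have [s0 s2 _ sE] := square_rootP k01.
rewrite /r /diamond; move: (square_root k) s0 s2 sE => s s0 s2 sE.
have -> : 1 / 2 + s < 1 by lra.
have d0 : 0 < 2 - s by lra.
have -> : (1 / 2 + s - 1 / 2 * s) / (1 - 1 / 2 * s) = (1 + s) / (2 - s).
  by field; rewrite !gt_eqF //; lra.
have ns : 0 < 1 - s ^+ 2 by nra.
have kE : k * (1 - s ^+ 2) = 2 * s - s ^+ 2.
  have -> : k * (1 - s ^+ 2) = k - s + s - k * s ^+ 2 by ring.
  by rewrite sE; ring.
split.
- rewrite ltr_pdivlMr // -(ltr_pM2r ns) mulrAC kE -subr_gt0.
  have -> : (1 + s) * (1 - s ^+ 2) - (2 * s - s ^+ 2) * (2 - s) =
    (1 - 2 * s) * (1 - s + s ^+ 2) by ring.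
  by rewrite mulr_gt0 //; nra.
- by rewrite ltr_pdivrMr //; lra.
- have -> : k = (2 * s - s ^+ 2) / (1 - s ^+ 2).
    by rewrite -kE mulfK // gt_eqF.
  by field; rewrite !gt_eqF //; nra.
Qed.

(** Each branch is decreasing, hence exchanges the two sides of its fixed
    point. *)
Lemma reflection_swap k xi (s := square_root k)
    (r := diamond (1 / 2) (square_root k)) :
  0 <= k < 1 -> 0 <= xi < 1 ->
  (s < xi < r) = ~~ (s <= diamond k (dinv xi) <= r).
Proof.
move=> k01 x01; have [s0 _ sk sE] := square_rootP k01.
have [kr _ rE] := half_turn_square_rootP k01.
rewrite -/s in s0 sk sE; rewrite -/r in kr rE; clearbody s r.
move: k01 x01 => /andP[k0 k1] /andP[x0 x1].
case: (leP xi k) => xk.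
  have /andP[y0 yk] := reflection_le k1 x0 xk.
  rewrite (le_lt_trans xk kr) (le_trans yk (ltW kr)) !andbT -ltNge.
  have d0 : 0 < 1 - xi + k * xi by nra.
  have c0 : 0 < 1 - s * (1 - k) by nra.
  rewrite diamond_dinv_le // ltr_pdivrMr //.
  rewrite -[LHS]subr_gt0 -[LHS](pmulr_lgt0 _ c0) -[RHS]subr_gt0; congr (0 < _).
  have -> : (xi - s) * (1 - s * (1 - k)) =
    s * (1 - xi + k * xi) - s * (1 - s + k * s) - s + xi by ring.
  by rewrite -sE; ring.
have /andP[yk y1] := reflection_gt k0 k1 xk x1.
rewrite (le_lt_trans sk xk) (le_trans sk (ltW yk)) /= -ltNge.
have d0 : 0 < 1 - k + k * xi by nra.
have c0 : 0 < 1 - k + r * k by nra.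
rewrite diamond_dinv_gt // ltr_pdivlMr //.
rewrite -[LHS]subr_gt0 -[LHS](pmulr_lgt0 _ c0) -[RHS]subr_gt0; congr (0 < _).
have -> : (r - xi) * (1 - k + r * k) =
  r * (1 - k + k * r) + r * (1 - k) - r * (1 - k + k * xi) - xi * (1 - k)
    by ring.
by rewrite -rE; ring.
Qed.

Lemma reflection_image k (s := square_root k)
    (r := diamond (1 / 2) (square_root k)) : 0 <= k < 1 ->
  (fun xi => diamond k (dinv xi)) @` [set` `]s, r[%R] =
  II R `\` [set` `[s, r]%R].
Proof.
move=> k01; have [s0 _ _ _] := square_rootP k01.
have [_ r1 _] := half_turn_square_rootP k01.
apply/seteqP; split=> [_ [xi xin <-]|y [] /=].
  move: xin; rewrite /= in_itv /= => xin.
  have x01 : 0 <= xi < 1.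
    case/andP: xin => sx xr.
    by rewrite (le_trans s0 (ltW sx)) (lt_trans xr r1).
  split; first by rewrite IIE reflection_II.
  by rewrite in_itv /=; apply/negP; rewrite -reflection_swap.
rewrite IIE => y01; rewrite in_itv /= => /negP yNin.
exists (diamond k (dinv y)); last exact: reflectionK.
by rewrite /= in_itv /= reflection_swap ?reflection_II // reflectionK.
Qed.

End Reflection.

(** * Reverse similarity in terms of squared sides *)

Section Similarity.
Set Implicit Arguments.
Unset Strict Implicit.
Variable R : realType.
Implicit Types (k l rho xi A B C X Y Z : R) (T U : otriangle R).

(** The square of the first side of the Ceva triangle; rotating its last three
    arguments gives the squares of the two other sides. *)
Definition ceva_sq rho A B C := rho * A + (1 - rho) * B + rho * (rho - 1) * C.

(** Squared form of reverse similarity. A multiplier in place of equal quotients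
    turns each case into identities that are linear in the squared sides. *)
Definition reversely_proportional A B C X Y Z := exists2 l : R, 0 <= l &
  [\/ [/\ Z = l * A, Y = l * B & X = l * C],
      [/\ Y = l * A, X = l * B & Z = l * C] |
      [/\ X = l * A, Z = l * B & Y = l * C]].

Lemma reversely_proportional_rot A B C X Y Z :
  reversely_proportional A B C X Y Z -> reversely_proportional B C A Y Z X.
Proof.
case=> l l0 [] [? ? ?]; exists l => //.
- exact: Or33.
- exact: Or31.
- exact: Or32.
Qed.

Lemma reversely_proportional_similar T U :
  reversely_proportional
    (side_a T ^+ 2) (side_b T ^+ 2) (side_c T ^+ 2)
    (side_a U ^+ 2) (side_b U ^+ 2) (side_c U ^+ 2) ->
  reversely_similar T U.
Proof.
have [a0 b0 c0 _] := otriangleP T; have [x0 y0 z0 _] := otriangleP U.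
rewrite /reversely_similar; move: (side_a T) (side_b T) (side_c T) a0 b0 c0.
move: (side_a U) (side_b U) (side_c U) x0 y0 z0.
move=> x y z x0 y0 z0 a b c a0 b0 c0 [l l0 h].
have ratio u v : 0 < u -> 0 < v -> v ^+ 2 = l * u ^+ 2 ->
    u / v = (Num.sqrt l)^-1.
  move=> u0 v0 e; have -> : v = Num.sqrt l * u.
    by rewrite -[LHS]gtr0_norm // -sqrtr_sqr e sqrtrM // sqrtr_sqr gtr0_norm.
  by rewrite invfM mulrCA divff ?mulr1 // gt_eqF.
case: h => [[h1 h2 h3]|[h1 h2 h3]|[h1 h2 h3]].
- by apply: Or31; rewrite (ratio a z) // (ratio b y) // (ratio c x).
- by apply: Or32; rewrite (ratio a y) // (ratio b x) // (ratio c z).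
- by apply: Or33; rewrite (ratio a x) // (ratio b z) // (ratio c y).
Qed.

Lemma side_ceva_sqr rho T
    (A := side_a T ^+ 2) (B := side_b T ^+ 2) (C := side_c T ^+ 2) :
  [/\ side_a (ceva rho T) ^+ 2 = ceva_sq rho A B C,
      side_b (ceva rho T) ^+ 2 = ceva_sq rho C A B &
      side_c (ceva rho T) ^+ 2 = ceva_sq rho B C A].
Proof.
have [] := otriangleP (ceva rho T).
rewrite /= /ceva_x /ceva_y /ceva_z !sqrtr_gt0 => x0 y0 z0 _.
by rewrite !sqr_sqrtr ?ltW // /ceva_sq /A /B /C; split; ring.
Qed.

(** On [0, k] the Ceva triangle is reflected with its first two sides
    exchanged; at xi = 0 this says that the operator of index k multiplies the
    squared sides by the norm 1 - k + k^2. *)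
Lemma ceva_sq_le k xi A B C (eta := diamond k (dinv xi)) :
  k < 1 -> 0 <= xi -> xi <= k -> A - B = k * (A - C) ->
  reversely_proportional
    (ceva_sq xi A B C) (ceva_sq xi C A B) (ceva_sq xi B C A)
    (ceva_sq eta A B C) (ceva_sq eta C A B) (ceva_sq eta B C A).
Proof.
move=> k1 x0 xk e; rewrite /eta diamond_dinv_le //.
have d0 : 1 - xi + k * xi != 0 by rewrite gt_eqF //; nra.
(* The ratio of the norms 1 - t + t^2 at eta and at xi, by which the areas
   of the two Ceva triangles compare. *)
exists ((1 - k + k ^+ 2) / (1 - xi + k * xi) ^+ 2).
  by rewrite divr_ge0 ?sqr_ge0 //; nra.
have -> : B = A - k * (A - C) by rewrite -e; ring.
by apply: Or32; rewrite /ceva_sq; split; field.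
Qed.

(** Beyond k the image index is 1 / (1 - f) with f the first branch, and the
    index change f |-> 1 / (1 - f) rotates the Ceva triangle, so the matching
    of the sides is the previous one followed by a rotation. *)
Lemma ceva_sq_gt k xi A B C (eta := diamond k (dinv xi)) :
  0 <= k -> k < 1 -> k < xi -> A - B = k * (A - C) ->
  reversely_proportional
    (ceva_sq xi A B C) (ceva_sq xi C A B) (ceva_sq xi B C A)
    (ceva_sq eta A B C) (ceva_sq eta C A B) (ceva_sq eta B C A).
Proof.
move=> k0 k1 kx e; rewrite /eta diamond_dinv_gt //.
have d0 : 1 - k + k * xi != 0 by rewrite gt_eqF //; nra.
exists ((1 - k + k ^+ 2) / (1 - k + k * xi) ^+ 2).
  by rewrite divr_ge0 ?sqr_ge0 //; nra.
have -> : B = A - k * (A - C) by rewrite -e; ring.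
by apply: Or33; rewrite /ceva_sq; split; field.
Qed.

(** The branches of [pp] undo the three rotations of the triangle; the value at
    infinity, where A = C and k = 0, belongs to the second one. *)
Lemma pp_varkappa T (k := pp (varkappa T))
    (A := side_a T ^+ 2) (B := side_b T ^+ 2) (C := side_c T ^+ 2) :
  [\/ A - B = k * (A - C), C - A = k * (C - B) | B - C = k * (B - A)].
Proof.
rewrite /k /varkappa -/A -/B -/C; case: eqVneq => [ac|ac] /=.
  by apply: Or32; rewrite mul0r /A /C ac subrr.
have [a0 _ c0 _] := otriangleP T.
have AC : A - C != 0 by rewrite subr_eq0 eqrXn2 // ?ltW.
clearbody A B C.
have tE : (A - B) / (A - C) * (A - C) = A - B by rewrite divfK.
case: ltP => t0.
  apply: Or32; move: tE t0; move: (_ / _) => t tE t0.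
  have -> : C - B = (C - A) * (1 - t) by move: tE; lra.
  by rewrite mulrC mulfK // gt_eqF //; lra.
case: ltP => t1; first by apply: Or31.
apply: Or33; rewrite mulrBl mul1r; move: tE t0 t1.
move: (_ / _) => t tE t0 t1.
have -> : B - A = - (t * (A - C)) by rewrite tE; ring.
rewrite mulrN mulKf ?gt_eqF //; last by lra.
by rewrite tE; ring.
Qed.

Lemma ceva_reflection_similar T xi : 0 <= xi < 1 ->
  reversely_similar (ceva xi T) (ceva (iota_map T xi) T).
Proof.
move=> /andP[x0 x1]; apply: reversely_proportional_similar.
have [-> -> ->] := side_ceva_sqr xi T.
have [-> -> ->] := side_ceva_sqr (iota_map T xi) T.
have := pp_varkappa T; have := pp_II (varkappa T); rewrite /iota_map.
move: (pp _) (_ ^+ 2) (_ ^+ 2) (_ ^+ 2) => k A B C /andP[k0 k1].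
have main A' B' C' : A' - B' = k * (A' - C') -> reversely_proportional
    (ceva_sq xi A' B' C') (ceva_sq xi C' A' B') (ceva_sq xi B' C' A')
    (ceva_sq (diamond k (dinv xi)) A' B' C')
    (ceva_sq (diamond k (dinv xi)) C' A' B')
    (ceva_sq (diamond k (dinv xi)) B' C' A').
  by case: (leP xi k) => xk; [apply: ceva_sq_le|apply: ceva_sq_gt].
case=> /main => [//|h|h].
- by do 2!apply: reversely_proportional_rot.
- exact: reversely_proportional_rot.
Qed.

End Similarity.

Theorem theorem10p4 (R : realType) (T : otriangle R) (hT : ~ equilateral T) :
  [/\ set_fun (II R) (II R) (iota_map T),
      iota_map T @` MM_interior T = II R `\` MM T &
      forall xi : R, MM T xi ->
        reversely_similar (ceva xi T) (ceva (iota_map T xi) T)].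
Proof.
have k01 := pp_II (varkappa T); split.
- by move=> xi; rewrite !IIE; apply: reflection_II.
- exact: reflection_image.
- move=> xi; rewrite /MM /= in_itv /= => /andP[lxi xir].
  have [s0 _ _ _] := square_rootP k01.
  have [_ r1 _] := half_turn_square_rootP k01.
  apply: ceva_reflection_similar.
  by rewrite (le_trans s0 lxi) (le_lt_trans xir r1).
Qed.
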